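(* There exists an absolute constant $C>0$ such that for all real $x,y$ with $2\le y\le \log x$, $$\frac{\Psi(x,y)}{1+\frac{y}{\log x}}\Big(1-C\Big(\frac{\log y}{y}+\frac{y}{\log x\cdot\log y}\Big)\Big)\le f(x,y)\le \Psi(x,y).$$
   Context: A chain is a finite sequence of pairwise distinct positive integers such that for any two consecutive terms, the smaller divides the larger; its length is its number of terms. For an integer $n\ge 2$, $P(n)$ denotes its largest prime factor, and $P(1)=1$. Let $\mathcal S(x,y)=\{n\le x: P(n)\le y\}$, $\Psi(x,y)=|\mathcal S(x,y)|$, and let $f(x,y)$ be the maximum length of a chain of integers of $\mathcal S(x,y)$. *)

(* Defs.v *)
From mathcomp Require Import all_boot all_order all_algebra finmap.
From mathcomp Require Import all_classical all_reals exp.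

Set Implicit Arguments.
Unset Strict Implicit.
Unset Printing Implicit Defensive.

Import Order.TTheory GRing.Theory Num.Theory.

Local Open Scope classical_set_scope.
Local Open Scope ring_scope.

(* The empty sequence counts as a chain (of length 0); this does not affect
   the maximum below, since [:: n] is a chain for every n > 0. *)
Definition chain (s : seq nat) : bool :=
  [&& all (fun n => 0 < n)%N s, uniq s &
      sorted (fun a b => minn a b %| maxn a b)%N s].

(* [max_pdiv n] is the largest prime factor of n when n > 1, and
   [max_pdiv 1 = 1], so it is P(n) for every positive n. *)
Definition smooth (R : realType) (x y : R) : set nat :=
  [set n | [/\ (0 < n)%N, n%:R <= x & (max_pdiv n)%:R <= y]].

Lemma finite_smooth (R : realType) (x y : R) : finite_set (smooth x y).
Proof.
apply: (@sub_finite_set _ _ `I_(Num.truncn x).+1); last exact: finite_II.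
move=> n [_ nx _] /=.
by rewrite ltnS truncn_ge_nat // (le_trans _ nx).
Qed.

(* [fset_set A] has the elements of A when A is finite, see [finite_smooth]. *)
Definition Psi (R : realType) (x y : R) : nat := #|` fset_set (smooth x y)|.

Definition has_chain (R : realType) (x y : R) : pred nat := fun k =>
  `[< exists s : seq nat,
        [/\ chain s, [set` s] `<=` smooth x y & size s = k] >].

Lemma has_chain0 (R : realType) (x y : R) : exists k, has_chain x y k.
Proof. by exists 0%N; apply/asboolP; exists [::]; split=> // n. Qed.

Lemma has_chain_le (R : realType) (x y : R) k :
  has_chain x y k -> (k <= Psi x y)%N.
Proof.
move=> /asboolP[s [/and3P[_ us _] sS <-]].
apply: uniq_leq_size => // n ns.
by rewrite in_fset_set ?inE; [exact: sS | exact: finite_smooth].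
Qed.

Definition max_chain_length (R : realType) (x y : R) : nat :=
  ex_maxn (has_chain0 x y) (@has_chain_le R x y).

(* Main.v *)
(* Write [X], [Y] for the integer parts of [x], [y], and [k = pi(Y)]. Fix [r], a
   small multiple of [log Y], and split the odd primes up to [Y] into the first [r]
   ones, [G1], and the others, [G2]. Every integer of S(x, y) is [2 ^ a * g * n] with
   [g] over [G1] and [n] over [G2].

   For [m] odd the line [m, 2m, 4m, ...] is a clique, hence a cycle, of the
   divisibility graph. Two disjoint cycles, one through [b -> 2b] and the other
   through [2bq -> bq], merge into one when these two edges are replaced by
   [b -> bq] and [2bq -> 2b]. First all lines with the same [n] are merged along
   the tree [g -> g / pdiv g], using edges at distinct powers of 2; then the
   resulting cycles are merged along the tree [n -> n / pdiv n], at the lines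
   [w * n] where the code word [w] over [G1] depends on the tree edge. There are
   enough code words because [E ^ r >= 2k] for a constant [E]. Only integers
   with [2 ^ B * g * n > X] or [M * n > X] are left out, for suitable [B] and [M].

   Let [t = y / log x <= 1]. Trading primes of an integer for powers of a smaller
   prime [q] shows that the integers prime to [q] are a proportion O(k log q / log x)
   of S(x, y). With Chebyshev's bounds, the first kind of lost integers then has
   proportion at most [t / 4], and so does the second kind, by applying this to
   the [r + 1] smallest primes. So the chain has length at least
   [(1 - t / 2) Psi >= Psi / (1 + t)] as soon as [y] is large; for bounded [y] a
   large [C] makes the lower bound nonpositive. *)
Require Import Defs.
From mathcomp Require Import all_boot all_order all_algebra.
From mathcomp Require Import all_classical all_reals exp.
From mathcomp Require Import zify ring lra.

Import Order.TTheory GRing.Theory Num.Theory.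

Set Implicit Arguments.
Unset Strict Implicit.
Unset Printing Implicit Defensive.

(** * Merging cycles along a tree *)

Section CycleInsertion.
Variables (T : eqType) (e : rel T).
Implicit Types (x y a b : T) (s g u v : seq T).

(** Only the pair astride the junction is lost, and it starts with [a]. *)
Lemma infix2_rcons_cat x y a u v : x != a ->
  infix [:: x; y] (rcons u a ++ v) ->
  infix [:: x; y] (rcons u a) || infix [:: x; y] v.
Proof.
move=> xa; elim: u => [|z u IHu].
  rewrite cat_rcons cat0s infix_consl => /orP[|->]; last by rewrite orbT.
  by rewrite /= (negPf xa).
rewrite rcons_cons cat_cons !infix_consl => /orP[|/IHu /orP[->|->]].
- by case: u {IHu} => [|t u] /= /and3P[-> -> _]; rewrite ?prefix0s.
- by rewrite orbT.
- by rewrite !orbT.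
Qed.

Lemma cycle_cat_last b b' u v :
  cycle e (b :: u) -> cycle e (b' :: v) ->
  e (last b u) b' -> e (last b' v) b -> cycle e ((b :: u) ++ b' :: v).
Proof.
rewrite /= !rcons_path cat_path last_cat /= => /andP[-> _] /andP[-> _] -> ->.
by [].
Qed.

(** The cycle [g], opened between [a'] and [b'], is inserted between [a] and [b]. The last two
    clauses record which edges stay available for further merges. *)
Lemma cycle_insert s g a b a' b' :
  cycle e s -> cycle e g -> infix [:: a; b] s -> infix [:: a'; b'] g ->
  e a b' -> e a' b ->
  exists c, [/\ cycle e c, perm_eq c (s ++ g),
    forall x y, x != a -> infix [:: x; y] s -> infix [:: x; y] c &
    forall x y, x != a' -> infix [:: x; y] g -> infix [:: x; y] c].
Proof.
move=> cs cg /infixP[s1 [s2 Es]] /infixP[g1 [g2 Eg]] eab' ea'b.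
have {}Es : s = rcons s1 a ++ b :: s2 by rewrite Es cat_rcons.
have {}Eg : g = rcons g1 a' ++ b' :: g2 by rewrite Eg cat_rcons.
subst s g.
exists (rcons s1 a ++ ((b' :: g2) ++ rcons g1 a') ++ b :: s2); split.
- rewrite catA cycle_catC catA.
  move: cs cg; rewrite cycle_catC /= => cs; rewrite cycle_catC /= => cg.
  apply: (@cycle_cat_last b b' (s2 ++ rcons s1 a) (g2 ++ rcons g1 a')) => //.
    by rewrite last_cat last_rcons.
  by rewrite last_cat last_rcons.
- apply/permP => p; rewrite -!cats1 !count_cat /=; lia.
- move=> x y xa /(infix2_rcons_cat xa) /orP[] h.
    exact: infix_catr.
  by rewrite catA; apply: infix_catl.
- move=> x y xa /(infix2_rcons_cat xa) /orP[] h.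
    by apply/infix_catl/infix_catr/infix_catl.
  by apply/infix_catl/infix_catr/infix_catr.
Qed.

End CycleInsertion.

(* The vertices [n] of a tree are linked to [n / pdiv n]. The edge of the cycle
   [piece n] carrying this link is labelled by the prime and the parity of its
   exponent: among the links at [n], the one to the parent and the one to the
   child [n * pdiv n] are told apart by this parity. *)
Lemma prime_tree_cycle (T : eqType) (e : rel T) (P Q : pred nat)
    (piece : nat -> seq T) (src tgt : nat -> nat * bool -> T) :
  P 1 -> (forall n, P n -> 0 < n) ->
  (forall n q, prime q -> P (n * q) -> P n /\ Q q) ->
  (forall n, P n -> cycle e (piece n) /\ uniq (piece n)) ->
  (forall m n x, P m -> P n -> x \in piece m -> x \in piece n -> m = n) ->
  (forall n q eps, prime q -> P (n * q) ->
     infix [:: src n (q, eps); tgt n (q, eps)] (piece n)) ->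
  (forall n q eps, prime q -> P (n * q) ->
     infix [:: src (n * q) (q, eps); tgt (n * q) (q, eps)] (piece (n * q))) ->
  (forall n q eps, prime q -> P (n * q) ->
     e (src n (q, eps)) (tgt (n * q) (q, eps)) /\
     e (src (n * q) (q, eps)) (tgt n (q, eps))) ->
  (forall m n p q a b, Q p -> Q q -> P m -> P n ->
     src m (p, a) = src n (q, b) -> [/\ m = n, p = q & a = b]) ->
  forall N, exists c, [/\ cycle e c, uniq c,
    forall x, x \in c <-> exists n, [/\ n <= N, P n & x \in piece n] &
    forall n x y, P n -> n <= N ->
      (forall m q eps, Q q -> P m -> x <> src m (q, eps)) ->
      infix [:: x; y] (piece n) -> infix [:: x; y] c].
Proof.
move=> P1 Pgt0 Pdiv cyc disj infp infc ee srcI N.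
pose code n := (pdiv n, odd (logn (pdiv n) n)).
have [par parK] : {par | forall n, par n * pdiv n = n}.
  by exists (fun n => n %/ pdiv n) => n; rewrite divnK // pdiv_dvd.
(* The induction keeps a finer record: only the links of vertices [m <= N] to their parents have
   spent edges. *)
suff [c [? ? ? Hc]] : exists c, [/\ cycle e c, uniq c,
    forall x, x \in c <-> exists n, [/\ n <= N, P n & x \in piece n] &
    forall n x y, P n -> n <= N ->
      (forall m, 1 < m <= N -> P m ->
         x <> src (par m) (code m) /\ x <> src m (code m)) ->
      infix [:: x; y] (piece n) -> infix [:: x; y] c].
  exists c; split=> // n x y Pn nN Hx; apply: Hc Pn nN _ => m /andP[m1 _] Pm.
  have [] // := Pdiv (par m) (pdiv m) (pdiv_prime m1).
    by rewrite parK.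
  by move=> Pp Qp; split; apply: Hx.
elim: N => [|N [c [cc uc mc ic]]].
  exists [::]; split=> // [x|n x y Pn].
    by split=> // -[n [n0 /Pgt0]]; lia.
  by move=> n0 /=; have := Pgt0 _ Pn; lia.
have [PN|nPN] := boolP (P N.+1); last first.
  exists c; split=> // [x|n x y Pn nN Hx].
    rewrite mc; split=> -[n [nN Pn xn]]; exists n; split=> //; first by lia.
    by move: nN; rewrite leq_eqVlt => /orP[/eqP E|//]; rewrite -E Pn in nPN.
  apply: ic => //.
    by move: nN; rewrite leq_eqVlt => /orP[/eqP E|//]; rewrite -E Pn in nPN.
  by move=> m /andP[m1 mN] Pm; apply: Hx => //; lia.
case: (posnP N) => [N0|N0].
  subst N; have [c1 u1] := cyc 1 P1.
  exists (piece 1); split=> // [x|n x y Pn n1 _].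
    split=> [x1|[n [n1 Pn xn]]]; first by exists 1.
    by have n0 := Pgt0 _ Pn; have <- : n = 1 by lia.
  by have n0 := Pgt0 _ Pn; have -> : n = 1 by lia.
have N1 : 1 < N.+1 by [].
set q := pdiv N.+1; have pq : prime q by apply: pdiv_prime.
have EN : par N.+1 * q = N.+1 by apply: parK.
have [|Pp Qq] := Pdiv (par N.+1) q pq; first by rewrite EN.
have pN : par N.+1 <= N.
  by have := ltn_Pmulr (prime_gt1 pq) (Pgt0 _ Pp); rewrite EN ltnS.
have [cN uN] := cyc _ PN.
have PEN : P (par N.+1 * q) by rewrite EN.
have [e1 e2] := ee (par N.+1) q (code N.+1).2 pq PEN.
rewrite EN in e1 e2.
have i2 := infc (par N.+1) q (code N.+1).2 pq PEN; rewrite EN in i2.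
have codeN : (q, (code N.+1).2) = code N.+1 by [].
rewrite codeN in e1 e2 i2.
(* At neither end does the link from [N.+1] to its parent reuse an edge spent by an earlier link. *)
have srcne m : 1 < m <= N -> P m ->
    [/\ src (par N.+1) (code N.+1) <> src (par m) (code m),
        src (par N.+1) (code N.+1) <> src m (code m),
        src N.+1 (code N.+1) <> src (par m) (code m) &
        src N.+1 (code N.+1) <> src m (code m)].
  move=> /andP[m1 mN] Pm; have pm : prime (pdiv m) by apply: pdiv_prime.
  have [|Ppm Qm] := Pdiv (par m) (pdiv m) pm; first by rewrite parK.
  split=> /srcI [] // E1 E2 E3.
  - have Em : m = N.+1 by rewrite -(parK m) -E1 -E2.
    by move: mN; rewrite Em ltnn.
  (* Here [m] is the parent of [N.+1] and both links carry the prime [q]; the parity of the exponent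
     separates them. *)
  - have El : logn q N.+1 = (logn q m).+1.
      rewrite -[X in logn q X]EN E1 lognM ?(Pgt0 m) ?prime_gt0 //.
      by rewrite (logn_prime q pq) eqxx addn1.
    by move: E3; rewrite -E2 -/q El /=; case: odd.
  - have := ltn_Pmulr (prime_gt1 pq) (ltn0Sn N).
    have -> : N.+1 * q = m by rewrite /q E2 {1}E1 parK.
    by move=> /leq_trans /(_ mN); rewrite ltnNge leqnSn.
  - by move: mN; rewrite -E1 ltnn.
have i1 : infix [:: src (par N.+1) (code N.+1); tgt (par N.+1) (code N.+1)] c.
  apply: (ic (par N.+1)) => //; last by rewrite -codeN; apply: infp.
  by move=> m mN Pm; have [] := srcne _ mN Pm.
have [c' [cc' pc' ic1 ic2]] := cycle_insert cc cN i1 i2 e1 e2.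
exists c'; split=> //.
- rewrite (perm_uniq pc') cat_uniq uc uN andbT /=.
  apply/hasPn => x xN; apply/negP => /mc [n [nN Pn xn]].
  by move: nN; rewrite (disj _ _ _ Pn PN xn xN) ltnn.
- move=> x; rewrite (perm_mem pc') mem_cat; split.
    move=> /orP[/mc [n [nN Pn xn]]|xN].
      by exists n; split=> //; exact: leqW.
    by exists N.+1.
  move=> [n [nN Pn xn]]; apply/orP.
  move: nN; rewrite leq_eqVlt => /orP[/eqP <-|nN]; first by right.
  by left; apply/mc; exists n.
- move=> n x y Pn nN Hx.
  have [|H1 H2] := Hx N.+1 _ PN; first by rewrite N1 leqnn.
  move: nN; rewrite leq_eqVlt => /orP[/eqP -> |nN] Hi.
    by apply: ic2 => //; apply/eqP.
  apply: ic1; first by apply/eqP.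
  by apply: (ic n) => // m /andP[m1 mN] Pm; apply: Hx; rewrite // m1 leqW.
Qed.

(** * Cycles through lines of powers of 2 *)

Definition dvd_rel : rel nat := fun a b => minn a b %| maxn a b.

Lemma dvd_rel_dvd a b : 0 < b -> a %| b -> dvd_rel a b.
Proof.
move=> b0 ab; have le := dvdn_leq b0 ab.
by rewrite /dvd_rel (minn_idPl le) (maxn_idPr le).
Qed.

Lemma dvd_rel_sym : symmetric dvd_rel.
Proof. by move=> a b; rewrite /dvd_rel minnC maxnC. Qed.

Lemma cycle_all2 (T : eqType) (e : rel T) (s : seq T) :
  (forall x y, x \in s -> y \in s -> e x y) -> cycle e s.
Proof.
have path_all2 x u : (forall y z, y \in x :: u -> z \in x :: u -> e y z) ->
    path e x u.
  elim: u x => //= y u IHu x exy; rewrite exy ?inE ?eqxx ?orbT //=.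
  by apply: IHu => z t zu tu; apply: exy; rewrite inE ?zu ?tu orbT.
case: s => //= x s exy; apply: path_all2 => y z.
rewrite -rcons_cons !mem_rcons !inE => yx zx.
by apply: exy; rewrite inE; [case/or3P: yx | case/or3P: zx] => ->; rewrite ?orbT.
Qed.

Section Lines.
Variables (X : nat) (s : nat -> bool).

Definition line m := [seq m * 2 ^ a | a <- iota 0 (trunc_log 2 (X %/ m)).+1].

(* [s m] is the parity of the number of prime factors of [m], so that the lines
   of [m] and [m * q] are traversed in opposite directions; this is what makes
   the edges added by a merge join comparable integers. *)
Definition oline m := if s m then rev (line m) else line m.

(** [esrc m b] and [etgt m b] are the ends of the edge of [oline m] between [m * 2 ^ b] and
    [m * 2 ^ b.+1], in the order of traversal. *)
Definition esrc m b := m * 2 ^ (b + s m).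

Definition etgt m b := m * 2 ^ (b + ~~ s m).

Lemma leq_trunc_log2 m a : 0 < m -> m <= X ->
  (a <= trunc_log 2 (X %/ m)) = (m * 2 ^ a <= X).
Proof.
move=> m0 mX; rewrite mulnC -leq_divRL //; apply/idP/idP => [|/trunc_log_max -> //].
move=> aL; apply: (@leq_trans (2 ^ trunc_log 2 (X %/ m))).
  by rewrite leq_exp2l.
by rewrite trunc_logP // divn_gt0.
Qed.

Lemma mem_oline m x : 0 < m -> m <= X ->
  x \in oline m <-> exists a, x = m * 2 ^ a /\ x <= X.
Proof.
move=> m0 mX; rewrite /oline; have -> : (x \in (if s m then rev (line m) else line m)) =
  (x \in line m) by case: ifP; rewrite ?mem_rev.
split=> [/mapP[a]|[a [-> aX]]].
  rewrite mem_iota add0n ltnS leq0n /= leq_trunc_log2 // => aX ->.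
  by exists a.
by apply: (map_f (fun a => m * 2 ^ a)); rewrite mem_iota add0n ltnS leq0n leq_trunc_log2.
Qed.

Lemma oline_uniq m : 0 < m -> uniq (oline m).
Proof.
move=> m0; have ul : uniq (line m).
  rewrite map_inj_uniq ?iota_uniq // => a b /eqP.
  by rewrite eqn_mul2l gtn_eqF //= eqn_exp2l // => /eqP.
by rewrite /oline; case: ifP; rewrite ?rev_uniq.
Qed.

Lemma oline_cycle m : 0 < m -> m <= X -> cycle dvd_rel (oline m).
Proof.
move=> m0 mX; apply: cycle_all2 => x y.
move=> /(mem_oline _ m0 mX)[a [-> _]] /(mem_oline _ m0 mX)[b [-> _]].
wlog ab : a b / a <= b.
  by move=> H; case/orP: (leq_total a b) => /H // h; rewrite dvd_rel_sym.
by apply: dvd_rel_dvd; rewrite ?muln_gt0 ?m0 ?expn_gt0 // dvdn_pmul2l // dvdn_exp2l.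
Qed.

Lemma oline_infix m b : 0 < m -> m * 2 ^ b.+1 <= X ->
  infix [:: esrc m b; etgt m b] (oline m).
Proof.
move=> m0 bX; have mX : m <= X.
  by apply: leq_trans bX; rewrite leq_pmulr // expn_gt0.
suff il : infix [:: m * 2 ^ b; m * 2 ^ b.+1] (line m).
  rewrite /oline /esrc /etgt; case: (s m); rewrite /= addn0 addn1 //.
  by rewrite -infix_rev revK.
have bL : b.+1 <= trunc_log 2 (X %/ m) by rewrite leq_trunc_log2.
rewrite /line; set L := trunc_log _ _ in bL *.
have -> : L.+1 = b + (2 + (L.-1 - b)) by lia.
rewrite iotaD map_cat; apply: infix_catl.
rewrite iotaD map_cat; apply: infix_catr.
by rewrite add0n; apply: infix_refl.
Qed.

(** Opposite directions put the source in one line and the target in the other at the same power of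
    2, so their quotient is [q]. *)
Lemma edge_link m q b : 0 < m -> 0 < q -> s (m * q) = ~~ s m ->
  dvd_rel (esrc m b) (etgt (m * q) b) /\ dvd_rel (esrc (m * q) b) (etgt m b).
Proof.
move=> m0 q0 sq; rewrite /esrc /etgt sq negbK; split.
  by apply: dvd_rel_dvd; rewrite ?muln_gt0 ?m0 ?q0 ?expn_gt0 // mulnAC dvdn_mulr.
rewrite dvd_rel_sym.
by apply: dvd_rel_dvd; rewrite ?muln_gt0 ?m0 ?q0 ?expn_gt0 // mulnAC dvdn_mulr.
Qed.

Lemma odd_mul_exp2_inj m n a b : odd m -> odd n ->
  m * 2 ^ a = n * 2 ^ b -> m = n /\ a = b.
Proof.
move=> om on E; have m0 := odd_gt0 om; have n0 := odd_gt0 on.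
have ab : a = b.
  move/(congr1 (logn 2)): E; rewrite !lognM ?expn_gt0 // !pfactorK //.
  by rewrite !logn_coprime ?coprime2n.
by subst b; move/eqP: E; rewrite eqn_mul2r expn_eq0 /= => /eqP.
Qed.

Lemma esrc_inj m n a b : odd m -> odd n -> esrc m a = esrc n b ->
  m = n /\ a = b.
Proof.
move=> om on /(odd_mul_exp2_inj om on) [-> /addIn]; by [].
Qed.

End Lines.

(** * Merging the lines over [G1], then the resulting cycles over [G2] *)

Section TwoLevels.
Variables (X B W : nat) (s : nat -> bool) (G1 G2 : nat_pred).
Variables (lab w : nat * bool -> nat).
Hypothesis oddG1 : forall q, q \in G1 -> odd q.
Hypothesis oddG2 : forall q, q \in G2 -> odd q.
Hypothesis disjG : forall q, q \in G1 -> q \notin G2.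
Hypothesis flip1 : forall m q, 0 < m -> prime q -> q \in G1 -> s (m * q) = ~~ s m.
Hypothesis flip2 : forall m q, 0 < m -> prime q -> q \in G2 -> s (m * q) = ~~ s m.
Hypothesis lab_gt0 : forall q a, q \in G1 -> 0 < lab (q, a).
Hypothesis lab_lt : forall q a, q \in G1 -> lab (q, a) < B.
Hypothesis lab_inj : forall p q a b, p \in G1 -> q \in G1 ->
  lab (p, a) = lab (q, b) -> p = q /\ a = b.
Hypothesis wG1 : forall q a, q \in G2 -> G1.-nat (w (q, a)).
Hypothesis w_le : forall q a, q \in G2 -> w (q, a) <= W.
Hypothesis w_inj : forall p q a b, p \in G2 -> q \in G2 ->
  w (p, a) = w (q, b) -> p = q /\ a = b.
Hypothesis W_gt0 : 0 < W.

Lemma odd_pnat (G : nat_pred) n : (forall q, q \in G -> odd q) -> G.-nat n -> odd n.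
Proof.
move=> oG Gn; have /andP[n0 _] := Gn; rewrite -[odd n]negbK -dvdn2.
by apply/negP => /(elimT (pnatP G n0) Gn 2 isT) /oG.
Qed.

Lemma pnat_mulr_prime (G : nat_pred) n q : prime q -> G.-nat (n * q) -> q \in G.
Proof. by move=> pq; rewrite pnatM => /andP[_]; rewrite pnatE. Qed.

(** The link for [(q, eps)] sits at the power [lab (q, eps)] of 2, and the bound with [2 ^ B] makes
    each line long enough for all labels. As labels are positive, the edge of label 0 of each line
    stays free for the merges over [G2]. *)
Lemma fibre_cycle k : odd k -> k * 2 ^ B <= X ->
  exists c, [/\ cycle dvd_rel c, uniq c,
    forall x, x \in c <-> exists g a,
      [/\ G1.-nat g, g * k * 2 ^ B <= X, x = g * k * 2 ^ a & x <= X] &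
    forall g, 0 < B -> G1.-nat g -> g * k * 2 ^ B <= X ->
      infix [:: esrc s (g * k) 0; etgt s (g * k) 0] c].
Proof.
move=> ok kX; have k0 := odd_gt0 ok.
pose P g := G1.-nat g && (g * k * 2 ^ B <= X).
have oddgk g : G1.-nat g -> odd (g * k).
  by move=> Gg; rewrite oddM ok (odd_pnat oddG1).
have P0 g : P g -> 0 < g by case/andP => /andP[].
have leB a b : a * 2 ^ b <= X -> a <= X.
  by apply: leq_trans; rewrite leq_pmulr // expn_gt0.
have P1 : P 1 by rewrite /P mul1n kX.
have PM g q : prime q -> P (g * q) -> P g /\ q \in G1.
  move=> pq /andP[Ggq h]; split; last exact: pnat_mulr_prime Ggq.
  move: Ggq; rewrite /P pnatM => /andP[-> _] /=.
  by apply: leq_trans h; rewrite !leq_mul2r leq_pmulr ?prime_gt0 ?orbT.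
have PG g q : prime q -> P (g * q) -> q \in G1.
  by move=> pq /(PM _ _ pq) [].
have Pinf g b : P g -> b < B ->
    infix [:: esrc s (g * k) b; etgt s (g * k) b] (oline X s (g * k)).
  move=> /andP[Gg gX] bB; apply: oline_infix; first exact/odd_gt0/oddgk.
  by apply: leq_trans gX; rewrite leq_mul2l leq_exp2l // bB orbT.
pose src g c := esrc s (g * k) (lab c).
pose tgt g c := etgt s (g * k) (lab c).
have [||||||c [cc uc mc ic]] := @prime_tree_cycle _ dvd_rel P (mem G1)
  (fun g => oline X s (g * k)) src tgt P1 P0 PM _ _ _ _ _ _ X.
- move=> g /andP[Gg /leB gX]; have gk0 := odd_gt0 (oddgk _ Gg).
  by split; [apply: oline_cycle | apply: oline_uniq].
- move=> g h x /andP[Gg /leB gX] /andP[Gh /leB hX].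
  have gk0 := odd_gt0 (oddgk _ Gg); have hk0 := odd_gt0 (oddgk _ Gh).
  move=> /(mem_oline _ _ gk0 gX)[a [-> _]] /(mem_oline _ _ hk0 hX)[b [E _]].
  have [/eqP] := odd_mul_exp2_inj (oddgk _ Gg) (oddgk _ Gh) E.
  by rewrite eqn_mul2r gtn_eqF //= => /eqP.
- by move=> g q a pq Pgq; apply: Pinf; [case: (PM g q) | apply/lab_lt/(PG g)].
- by move=> g q a pq Pgq; apply: Pinf; [ | apply/lab_lt/(PG g)].
- move=> g q a pq Pgq; rewrite /src /tgt mulnAC; apply: edge_link.
  + by rewrite muln_gt0 k0 andbT; apply: P0; case: (PM g q pq Pgq).
  + exact: prime_gt0.
  + apply: flip1; rewrite ?(PG g) // muln_gt0 k0 andbT.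
    by apply: P0; case: (PM g q pq Pgq).
- move=> g h p q a b Gp Gq /andP[Gg _] /andP[Gh _].
  move=> /(esrc_inj (oddgk _ Gg) (oddgk _ Gh)) [E1 E2].
  have [-> ->] := lab_inj Gp Gq E2; split=> //.
  by move/eqP: E1; rewrite eqn_mul2r gtn_eqF //= => /eqP.
exists c; split=> //.
- move=> x; rewrite mc; split=> [[g [gX /andP[Gg hX] xg]]|[g [a [Gg gX -> xX]]]].
    have [a [-> aX]] := (mem_oline s x (odd_gt0 (oddgk _ Gg)) (leB _ _ hX)).1 xg.
    by exists g, a.
  exists g; split.
  + by apply: leq_trans (leB _ _ gX); rewrite leq_pmulr.
  + by rewrite /P Gg.
  + by apply/(mem_oline s _ (odd_gt0 (oddgk _ Gg)) (leB _ _ gX)); exists a.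
- move=> g B0 Gg gX; have Pg : P g by rewrite /P Gg.
  apply: (ic g) => //; last exact: Pinf.
    by apply: leq_trans (leB _ _ gX); rewrite leq_pmulr.
  move=> h q a Gq /andP[Gh _] /(esrc_inj (oddgk _ Gg) (oddgk _ Gh)) [_ E].
  by have := lab_gt0 a Gq; rewrite -E.
Qed.

Lemma mul_pnat_inj g h m n : G1.-nat g -> G1.-nat h -> G2.-nat m -> G2.-nat n ->
  g * m = h * n -> g = h /\ m = n.
Proof.
move=> Gg Gh Gm Gn E.
have p' k : G1.-nat k -> G2^'.-nat k.
  by apply: sub_in_pnat => p _ /disjG.
have mn : m = n.
  have := congr1 (fun k => k`_G2) E; move: (Gg) (Gh) (Gm) (Gn).
  move=> /andP[g0 _] /andP[h0 _] /andP[m0 _] /andP[n0 _].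
  by rewrite !partnM // (part_p'nat (p' _ Gg)) (part_p'nat (p' _ Gh)) !mul1n !part_pnat_id.
split=> //; subst n; case/andP: Gm => m0 _.
by move/eqP: E; rewrite eqn_mul2r gtn_eqF //= => /eqP.
Qed.

Lemma two_level_cycle : 0 < B -> W * 2 ^ B <= X ->
  exists c, [/\ cycle dvd_rel c, uniq c &
    forall x, x \in c <-> exists g n a,
      [/\ G1.-nat g, G2.-nat n, g * n * 2 ^ B <= X, n * (W * 2 ^ B) <= X &
          x = g * n * 2 ^ a /\ x <= X]].
Proof.
move=> B0 WX.
pose P n := G2.-nat n && (n * (W * 2 ^ B) <= X).
have odd2 n : G2.-nat n -> odd n by exact: odd_pnat.
have P0 n : P n -> 0 < n by case/andP => /andP[].
have PX n : P n -> n * 2 ^ B <= X.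
  case/andP=> _; apply: leq_trans; rewrite leq_mul2l leq_pmull ?orbT //.
have P1 : P 1 by rewrite /P mul1n WX.
have PM n q : prime q -> P (n * q) -> P n /\ q \in G2.
  move=> pq /andP[Ggq h]; split; last exact: pnat_mulr_prime Ggq.
  move: Ggq; rewrite /P pnatM => /andP[-> _] /=.
  by apply: leq_trans h; rewrite !leq_mul2r leq_pmulr ?prime_gt0 ?orbT.
have fibre n : exists c, P n ->
    [/\ cycle dvd_rel c, uniq c,
      forall x, x \in c <-> exists g a,
      [/\ G1.-nat g, g * n * 2 ^ B <= X, x = g * n * 2 ^ a & x <= X] &
    forall g, 0 < B -> G1.-nat g -> g * n * 2 ^ B <= X ->
      infix [:: esrc s (g * n) 0; etgt s (g * n) 0] c].
  have [Pn|] := boolP (P n); last by exists [::].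
  have [|c Hc] := @fibre_cycle n _ (PX _ Pn); first by case/andP: Pn => /odd2.
  by exists c.
have [F HF] := choice fibre.
pose src n c := esrc s (w c * n) 0.
pose tgt n c := etgt s (w c * n) 0.
have wX n q a : q \in G2 -> P n -> w (q, a) * n * 2 ^ B <= X.
  move=> Gq /andP[_]; apply: leq_trans.
  by rewrite mulnAC mulnC leq_mul2l leq_mul2r w_le ?orbT.
have inf n q a : q \in G2 -> P n -> infix [:: src n (q, a); tgt n (q, a)] (F n).
  move=> Gq Pn; have [_ _ _ ->] // := HF _ Pn; first exact: wG1.
  exact: wX.
have oddm g n : G1.-nat g -> G2.-nat n -> odd (g * n).
  by move=> /(odd_pnat oddG1) og /odd2 on; rewrite oddM og.
have [||||||c [cc uc mc _]] := @prime_tree_cycle _ dvd_rel P (mem G2)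
  F src tgt P1 P0 PM _ _ _ _ _ _ X.
- by move=> n /HF [].
- move=> m n x Pm Pn; have [_ _ -> _] := HF _ Pm; have [_ _ -> _] := HF _ Pn.
  case/andP: Pm Pn => Gm _ /andP[Gn _] [g [a [Gg _ -> _]]] [h [b [Gh _ E _]]].
  have [E1 _] := odd_mul_exp2_inj (oddm _ _ Gg Gm) (oddm _ _ Gh Gn) E.
  by have [] := mul_pnat_inj Gg Gh Gm Gn E1.
- by move=> n q a pq /(PM _ _ pq)[Pn Gq]; apply: inf.
- by move=> n q a pq Pnq; have [Pn Gq] := PM _ _ pq Pnq; apply: inf.
- move=> n q a pq Pnq; have [Pn Gq] := PM _ _ pq Pnq.
  have /andP[w0 _] := wG1 a Gq.
  have wn0 : 0 < w (q, a) * n by rewrite muln_gt0 w0 P0.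
  rewrite /src /tgt mulnA; apply: edge_link => //; first exact: prime_gt0.
  exact: flip2.
- move=> m n p q a b Gp Gq /andP[Gm _] /andP[Gn _].
  have Gwp := wG1 a Gp; have Gwq := wG1 b Gq.
  move=> /(esrc_inj (oddm _ _ Gwp Gm) (oddm _ _ Gwq Gn)) [E _].
  have [Ew ->] := mul_pnat_inj Gwp Gwq Gm Gn E.
  by have [-> ->] := w_inj Gp Gq Ew.
exists c; split=> // x; rewrite mc; split.
  move=> [n [nX Pn]]; have [_ _ -> _] := HF _ Pn; case/andP: Pn => Gn nWX.
  by move=> [g [a [Gg gX -> xX]]]; exists g, n, a.
move=> [g [n [a [Gg Gn gX nWX [-> xX]]]]].
have Pn : P n by rewrite /P Gn.
exists n; split=> //.
  by apply: leq_trans nWX; rewrite leq_pmulr // muln_gt0 W_gt0 expn_gt0.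
by have [_ _ -> _] := HF _ Pn; exists g, a.
Qed.

End TwoLevels.

(** * Proportion of integers prime to small primes *)

Definition among (A : seq nat) : nat_pred := [pred p | p \in A].

Definition npnat (G : nat_pred) X := #|[set n : 'I_X.+1 | G.-nat n]|.

Lemma prod_exp_gt0 (A : seq nat) (f : nat -> nat) :
  all prime A -> 0 < \prod_(p <- A) p ^ f p.
Proof.
move=> prA; rewrite big_seq prodn_cond_gt0 // => p pA.
by rewrite expn_gt0 prime_gt0 // (allP prA).
Qed.

Lemma logn_prod_seq (A : seq nat) (f : nat -> nat) q :
  uniq A -> all prime A ->
  logn q (\prod_(p <- A) p ^ f p) = if q \in A then f q else 0.
Proof.
elim: A => [|p A IHA] /=; first by rewrite big_nil logn1.
case/andP=> pA uA /andP[pp prA]; rewrite big_cons inE.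
rewrite lognM ?prod_exp_gt0 ?expn_gt0 ?prime_gt0 //.
rewrite IHA // lognX logn_prime //.
case: (eqVneq q p) => [->|_]; last by rewrite muln0.
by rewrite (negPf pA) muln1 addn0.
Qed.

Lemma pnat_prodE (A : seq nat) n : uniq A -> all prime A -> (among A).-nat n ->
  n = \prod_(p <- A) p ^ logn p n.
Proof.
move=> uA prA An; case/andP: (An) => n0 _.
apply: eqn_from_log => //; first exact: prod_exp_gt0.
move=> q; rewrite logn_prod_seq //; case: ifP => // qA.
apply/eqP; rewrite -leqn0 leqNgt logn_gt0; apply/negP => qn.
by have := pnatPpi An qn; rewrite inE qA.
Qed.

Lemma leq_card_interval X t (R : pred nat) : t <= X ->
  (forall b, 0 < b <= t -> R b) -> t <= #|[set b : 'I_X.+1 | R b]|.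
Proof.
move=> tX Rt; rewrite cardE -(size_map val) -[t in t <= _](size_iota 1).
apply: uniq_leq_size; first exact: iota_uniq.
move=> b; rewrite mem_iota add1n ltnS => bt.
have bX : b < X.+1 by case/andP: bt => _ /leq_trans; apply.
apply/mapP; exists (Ordinal bX) => //.
by rewrite mem_enum inE /= Rt.
Qed.

Section MassTransfer.
Variables (X q : nat) (A : seq nat).
Hypotheses (pq : prime q) (uA : uniq A) (prA : all prime A).
Hypothesis qA : all (ltn q) A.

Let S := [set n : 'I_X.+1 | (among A).-nat n].

(** The map [(n, b) |-> n %/ D b * q ^ b] is injective: [q] is not in [A], so [b] is the exponent of
    [q] in the image, and then [D b] gives back [n]. *)
Lemma transfer_count (D tau : nat -> nat) :
  (forall n, n \in S -> tau n <= X) ->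
  (forall (n : 'I_X.+1) b, n \in S -> 0 < b <= tau n ->
     D b %| n /\ n %/ D b * q ^ b <= X) ->
  \sum_(n in S) tau n <= npnat (among (q :: A)) X.
Proof.
move=> tX HD.
pose R n b := [&& 0 < b, D b %| n & n %/ D b * q ^ b <= X].
apply: (@leq_trans #|[set nb : 'I_X.+1 * 'I_X.+1 | (nb.1 \in S) && R nb.1 nb.2]|).
  rewrite -sum1dep_card -(pair_big_dep (mem S) (fun n b : 'I_X.+1 => R n b) (fun _ _ => 1)) /=.
  apply: leq_sum => n nS; rewrite sum1dep_card.
  apply: (leq_card_interval (R := R n)); first exact: tX.
  by move=> b bt; have [? ?] := HD n b nS bt; apply/and3P; split=> //; case/andP: bt.
have Sgt0 (n : 'I_X.+1) : n \in S -> 0 < n by rewrite inE => /andP[].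
have qNA : q \notin A by apply/negP => /(allP qA); rewrite /= ltnn.
pose f (nb : 'I_X.+1 * 'I_X.+1) : 'I_X.+1 := inord (nb.1 %/ D nb.2 * q ^ nb.2).
have fE (n b : 'I_X.+1) : R n b -> val (f (n, b)) = n %/ D b * q ^ b.
  by case/and3P=> _ _ h; rewrite /= inordK.
have lq (n b : 'I_X.+1) : n \in S -> R n b -> logn q (n %/ D b * q ^ b) = b.
  move=> nS /and3P[b0 Dn _]; have n0 := Sgt0 _ nS.
  have Sn : (among A).-nat (n %/ D b) by apply: pnat_div => //; rewrite inE in nS.
  have /andP[d0 _] := Sn; rewrite lognM ?d0 ?expn_gt0 ?(prime_gt0 pq) //.
  rewrite pfactorK // -[RHS]add0n; congr (_ + _).
  apply/eqP; rewrite -leqn0 leqNgt logn_gt0; apply/negP => /(pnatPpi Sn).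
  by rewrite inE (negPf qNA).
rewrite -(card_in_imset (f := f)); last first.
  move=> [n b] [m d]; rewrite !inE /= => /andP[nS Rnb] /andP[mS Rmd].
  move=> /(congr1 val); rewrite !fE // => E.
  have bd : b = d.
    apply: val_inj; rewrite /= -(lq n b) ?inE // E; apply: lq => //.
    by rewrite inE.
  subst d; congr pair; apply: val_inj => /=; move/eqP: E.
  rewrite eqn_mul2r expn_eq0 (gtn_eqF (prime_gt0 pq)) /= => /eqP E.
  case/and3P: Rnb => _ /divnK <- _; case/and3P: Rmd => _ /divnK <- _.
  by rewrite E.
apply/subset_leq_card/fintype.subsetP => m /imsetP[[n b]]; rewrite !inE /=.
move=> /andP[nS Rnb] ->; have := fE _ _ Rnb => /= ->.
case/and3P: Rnb => b0 Dn _; rewrite pnatM; apply/andP; split.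
  apply: pnat_div => //; apply: sub_in_pnat nS => p _.
  by rewrite !inE => ->; rewrite orbT.
by rewrite pnatX pnatE // !inE eqxx.
Qed.

(** The number of [b > 0] for which the [p]-part of [n] can be traded for [q ^ b]. *)
Let tau p n := trunc_log q (p ^ logn p n).

(* An element [n] of [S] is turned into [trunc_log q X / 2] or more pairs
   [(p, b)], each giving the multiple [n / p ^ j * q ^ b] of [q] with the least
   [j] such that [q ^ b <= p ^ j]; [p] and this multiple determine [n] and [b]. *)
Lemma mass_transfer :
  trunc_log q X * npnat (among A) X <=
  2 * (size A).+1 * npnat (among (q :: A)) X.
Proof.
have q1 := prime_gt1 pq.
have Sgt0 (n : 'I_X.+1) : n \in S -> 0 < n by rewrite inE => /andP[].
have trunc_le p (n : 'I_X.+1) : prime p -> n \in S -> tau p n <= X.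
  move=> pp nS; apply/ltnW; apply: leq_trans (ltn_expl _ q1) _.
  apply: (@leq_trans (p ^ logn p n)).
    by apply: trunc_logP; rewrite // expn_gt0 prime_gt0.
  apply: (@leq_trans n); last exact: leq_ord.
  by apply: dvdn_leq; [exact: Sgt0 | exact: pfactor_dvdnn].
have taup p : p \in A -> \sum_(n in S) tau p n <= npnat (among (q :: A)) X.
  move=> pA; have pp := allP prA _ pA; have p1 := prime_gt1 pp.
  apply: (transfer_count (D := fun b => p ^ up_log p (q ^ b))).
    by move=> n; apply: trunc_le.
  move=> n b nS /andP[b0 bt]; have n0 := Sgt0 _ nS.
  have qp : q ^ b <= p ^ logn p n.
    apply: (@leq_trans (q ^ tau p n)); first by rewrite leq_exp2l.
    by apply: trunc_logP; rewrite // expn_gt0 prime_gt0.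
  have pD : p ^ up_log p (q ^ b) %| n.
    rewrite pfactor_dvdn //; exact: up_log_min.
  split=> //; apply: (@leq_trans (n %/ p ^ up_log p (q ^ b) * p ^ up_log p (q ^ b))).
    by rewrite leq_mul2l up_logP ?orbT.
  by rewrite divnK // leq_ord.
(* Nothing is divided out here: the room between [n] and [X] is filled with powers of [q]. This
   accounts for the extra 1 in [(size A).+1]. *)
have tau0 : \sum_(n in S) trunc_log q (X %/ n) <= npnat (among (q :: A)) X.
  have tle (n : 'I_X.+1) : n \in S -> q ^ trunc_log q (X %/ n) <= X %/ n.
    by move=> nS; apply: trunc_logP => //; rewrite divn_gt0 ?Sgt0 ?leq_ord.
  apply: (transfer_count (D := fun=> 1) (tau := fun n => trunc_log q (X %/ n))).
    move=> n nS; apply/ltnW; apply: leq_trans (ltn_expl _ q1) _.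
    by apply: leq_trans (tle _ nS) _; apply: leq_div.
  move=> n b nS /andP[b0 bt]; split; first exact: dvd1n.
  rewrite divn1 mulnC -leq_divRL ?Sgt0 //; apply: leq_trans (tle _ nS).
  by rewrite leq_exp2l.
(* A prime [p] of [A] dividing [n] exceeds [q], so [tau p n >= 1] and the [p]-part of [n] is below
   [q ^ (tau p n).+1 <= q ^ (2 * tau p n)]. This is the source of the factor 2. *)
have pointwise n : n \in S ->
    trunc_log q X <= 2 * (trunc_log q (X %/ n) + \sum_(p <- A) tau p n).
  move=> nS; have n0 := Sgt0 _ nS.
  have nle : n <= q ^ (2 * \sum_(p <- A) tau p n).
    have An : (among A).-nat n by move: nS; rewrite inE.
    rewrite [X in X <= _](pnat_prodE uA prA An) big_distrr /= expn_sum.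
    rewrite !big_seq; apply: leq_prod => p pA.
    have p0 := prime_gt0 (allP prA _ pA).
    case: (posnP (logn p n)) => [->|l0]; first by rewrite expn0 expn_gt0 prime_gt0.
    have : 0 < tau p n.
      apply: trunc_log_max => //; rewrite expn1.
      apply: leq_trans (ltnW (allP qA _ pA)) _.
      by rewrite -[X in X <= _]expn1 leq_pexp2l.
    move=> t0; apply: (@leq_trans (q ^ (tau p n).+1)).
      exact/ltnW/trunc_log_ltn.
    by rewrite leq_exp2l // mul2n -addnn -addn1 leq_add2l.
  rewrite -ltnS -(ltn_exp2l _ _ q1).
  have X0 : 0 < X by apply: leq_trans (leq_ord n).
  apply: (leq_ltn_trans (trunc_logP q1 X0)).
  apply: (@leq_trans (q ^ (trunc_log q (X %/ n)).+1 * n)).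
    by rewrite -ltn_divLR // trunc_log_ltn.
  apply: (@leq_trans (q ^ (trunc_log q (X %/ n)).+1 * q ^ (2 * \sum_(p <- A) tau p n))).
    by rewrite leq_mul2l nle orbT.
  rewrite -expnD leq_exp2l //; lia.
rewrite mulnC -sum_nat_const.
apply: (@leq_trans (\sum_(n in S) 2 * (trunc_log q (X %/ n) + \sum_(p <- A) tau p n))).
  exact: leq_sum.
rewrite -big_distrr /= -mulnA leq_mul2l /= big_split /= mulSn leq_add //.
rewrite exchange_big /= -sum1_size big_distrl /= !big_seq.
by apply: leq_sum => p pA; rewrite mul1n taup.
Qed.

End MassTransfer.

(** The order is increasing because [mass_transfer] wants [q] below all the other primes. Each prime
    of [G] costs a factor of at most [2 * size (G ++ R) / Q]. *)
Lemma iter_mass_transfer X Q (G R : seq nat) :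
  sorted ltn (G ++ R) -> all prime (G ++ R) ->
  (forall p, p \in G -> Q <= trunc_log p X) ->
  Q ^ size G * npnat (among R) X <=
  (2 * size (G ++ R)) ^ size G * npnat (among (G ++ R)) X.
Proof.
elim: G => [|q G IHG] //= sGR /andP[pq pGR] HQ.
have sGR' := path_sorted sGR.
have uGR : uniq (G ++ R) by apply: sorted_uniq sGR'; [exact: ltn_trans | exact: ltnn].
have := IHG sGR' pGR (fun p pG => HQ p (mem_behead (s := q :: G) pG)).
set k := size (G ++ R); set N1 := npnat _ _; set N2 := npnat _ _ => IH.
have := @mass_transfer X q _ pq uGR pGR (order_path_min ltn_trans sGR).
rewrite -/k -/N2; set N3 := npnat _ _ => MT.
have HQq := HQ q (mem_head _ _).
rewrite !expnS -mulnA.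
apply: (@leq_trans (Q * ((2 * k) ^ size G * N2))).
  by rewrite leq_mul2l IH orbT.
rewrite mulnCA.
apply: (@leq_trans ((2 * k) ^ size G * (2 * k.+1 * N3))).
  rewrite leq_mul2l; apply/orP; right; apply: leq_trans MT.
  by rewrite leq_mul2r HQq orbT.
rewrite [X in _ <= X]mulnAC mulnC leq_mul2l; apply/orP; right.
by case: (size G) => // j; rewrite leq_exp2r // leq_mul2l ltnW ?orbT.
Qed.

(** * Integers with small prime factors *)

Lemma leq_bin_exp2 n k : 'C(n, k) <= 2 ^ n.
Proof.
elim: n k => [|n IHn] [|k]; rewrite ?bin0 ?expn_gt0 //.
by rewrite binS expnS mul2n -addnn leq_add.
Qed.

(* Writing the exponents as [sigma * b + c] with [c < sigma], the quotients [b]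
   have sum at most [size A]. *)
Lemma npnat_exp2_le (A : seq nat) sigma s : uniq A -> all prime A ->
  0 < sigma -> s <= size A * sigma ->
  npnat (among A) (2 ^ s) <= (4 * sigma) ^ size A.
Proof.
move=> uA prA; case: sigma => // sg _ sA; set sigma := sg.+1; set j := size A.
pose e (n : nat) (i : 'I_j) := logn (nth 0 A i) n.
pose b (n : nat) : j.-tuple 'I_j.+1 := [tuple inord (e n i %/ sigma) | i < j].
pose c (n : nat) : j.-tuple 'I_sigma := [tuple inord (e n i %% sigma) | i < j].
pose U := [set t : j.-tuple 'I_j.+1 | \sum_(i <- t) i <= j].
pose S := [set n : 'I_(2 ^ s).+1 | (among A).-nat n].
have sum_e (n : 'I_(2 ^ s).+1) : n \in S -> \sum_(i < j) e n i <= s.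
  rewrite inE => An; rewrite -(leq_exp2l (m := 2)) // expn_sum.
  apply: leq_trans (leq_ord n); rewrite [X in _ <= X](pnat_prodE uA prA An).
  rewrite (big_nth 0) big_mkord; apply: leq_prod => i _.
  rewrite -/(e n i); case: (e n i) => // k; rewrite leq_exp2r //.
  by apply/prime_gt1/(allP prA)/mem_nth.
have quo (n : 'I_(2 ^ s).+1) : n \in S -> \sum_(i < j) (e n i %/ sigma) <= j.
  move=> /sum_e h; rewrite -(leq_pmul2r (m := sigma)) // big_distrl /=.
  apply: leq_trans (leq_trans h sA); apply: leq_sum => i _; exact: leq_divM.
have bE (n : 'I_(2 ^ s).+1) i : n \in S -> tnth (b n) i = e n i %/ sigma :> nat.
  move=> nS; rewrite tnth_mktuple inordK // ltnS; apply: leq_trans (quo _ nS).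
  by rewrite (bigD1 i) //= leq_addr.
have cE (n : nat) i : tnth (c n) i = e n i %% sigma :> nat.
  by rewrite tnth_mktuple inordK // ltn_mod.
(* There are ['C(j + j, j) <= 2 ^ (j + j)] tuples of quotients and [sigma ^ j] tuples of
   remainders. *)
have -> : (4 * sigma) ^ j = 2 ^ (j + j) * sigma ^ j.
  by rewrite addnn -mul2n expnM expnMn.
apply: (@leq_trans #|finset.setX U [set: j.-tuple 'I_sigma]|); last first.
  rewrite finset.cardsX finset.cardsT card_tuple card_ord card_partial_ord_partitions.
  by rewrite leq_mul2r leq_bin_exp2 orbT.
rewrite /npnat -/S -(card_in_imset (f := fun n : 'I_(2 ^ s).+1 => (b n, c n))).
  apply/subset_leq_card/fintype.subsetP => t /imsetP[n nS ->].
  rewrite !inE andbT big_tuple; apply: leq_trans (quo n nS).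
  by apply: eq_leq; apply: eq_bigr => i _; rewrite bE.
move=> m n mS nS Ebc; apply: val_inj => /=.
have Eb : b m = b n by exact: (congr1 fst Ebc).
have Ec : c m = c n by exact: (congr1 snd Ebc).
have /(pnat_prodE uA prA) Em : (among A).-nat m by rewrite inE in mS.
have /(pnat_prodE uA prA) En : (among A).-nat n by rewrite inE in nS.
rewrite [LHS]Em [RHS]En; apply: eq_big_seq => p pA; congr (_ ^ _).
have iA : index p A < j by rewrite index_mem.
have eE k : e k (Ordinal iA) = logn p k by rewrite /e /= nth_index.
have Eb' := congr1 (fun t : j.-tuple 'I_j.+1 => nat_of_ord (tnth t (Ordinal iA))) Eb.
have Ec' := congr1 (fun t : j.-tuple 'I_sigma => nat_of_ord (tnth t (Ordinal iA))) Ec.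
rewrite !bE // !eE in Eb'; rewrite !cE !eE in Ec'.
by rewrite (divn_eq (logn p m) sigma) Eb' Ec' -divn_eq.
Qed.

(** The words are the products of primes of [A] with exponents below [E], distinct by unique
    factorization; each factor is at most [p ^ E <= 2 ^ (h * E)]. *)
Lemma code_words (A : seq nat) E h : uniq A -> all prime A ->
  (forall p, p \in A -> p <= 2 ^ h) ->
  exists w : nat -> nat,
    (forall i, (among A).-nat (w i) /\ w i <= 2 ^ (h * E * size A)) /\
    (forall i j, i < E ^ size A -> j < E ^ size A -> w i = w j -> i = j).
Proof.
move=> uA prA Ah; set r := size A.
pose words := enum {: r.-tuple 'I_E}.
have sw : size words = E ^ r by rewrite -cardE card_tuple card_ord.
(* Past the end of [words] the default [[::]] makes all exponents 0, so the size bound holds for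
   every [i]. *)
pose f i p :=
  nth 0 (nth [::] [seq map (@nat_of_ord E) (tval t) | t <- words] i) (index p A).
pose w i := \prod_(p <- A) p ^ f i p.
have fE i p : f i p <= E.
  rewrite /f; case: (ltnP i (size words)) => iw; last first.
    rewrite [X in nth 0 X]nth_default; last by rewrite size_map.
    by rewrite nth_nil.
  have [t0 _] : exists t0, t0 \in words.
    by move: iw; case: (words) => // t0 s _; exists t0; rewrite mem_head.
  rewrite (nth_map t0) //; set t := nth t0 _ _.
  case: (ltnP (index p A) r) => ir; last by rewrite nth_default ?size_map ?size_tuple.
  have x0 : 'I_E by case: t => -[|x ?] // /eqP Es; move: ir; rewrite -Es.
  by rewrite (nth_map x0) ?size_tuple //; apply/ltnW/ltn_ord.
exists w; split.
  move=> i; split.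
    rewrite /w big_seq; apply: (big_ind (fun n => (among A).-nat n)) => [|m n Am An|p pA].
    - by [].
    - by rewrite pnatM Am An.
    by rewrite pnatX pnatE ?inE ?pA // (allP prA).
  rewrite /w expnM -/r /r -sum1_size -[X in X ^ _]/(2 ^ (h * E)).
  rewrite expn_sum !big_seq; apply: leq_prod => p pA; rewrite expn1 expnM.
  apply: (@leq_trans (p ^ E)); first by rewrite leq_pexp2l ?prime_gt0 // (allP prA).
  by case: (E) => // E'; rewrite leq_exp2r // Ah.
move=> i j iE jE wij.
have fij p : p \in A -> f i p = f j p.
  move=> pA; have := congr1 (logn p) wij.
  by rewrite !logn_prod_seq // pA.
have iw : i < size words by rewrite sw.
have jw : j < size words by rewrite sw.
have [t0 _] : exists t0, t0 \in words.
  by move: iE; rewrite -sw; case: (words) => // t0 s _; exists t0; rewrite mem_head.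
apply/eqP; rewrite -(nth_uniq t0 _ _ (enum_uniq _ : uniq words)) ?sw //; apply/eqP.
apply: val_inj; apply: (inj_map (@ord_inj E)) => /=.
apply: (@eq_from_nth _ 0); first by rewrite !size_map !size_tuple.
move=> k; rewrite size_map size_tuple => kr.
have := fij (nth 0 A k) (mem_nth 0 kr).
by rewrite /f index_uniq // (nth_map t0 _ _ iw) (nth_map t0 _ _ jw).
Qed.

(** * A cycle through most smooth integers *)

Lemma card_ltn_mul (X a b : nat) (U : {set 'I_a.+1}) (V : {set 'I_b.+1})
    (S : {set 'I_X.+1}) (f : nat -> nat) :
  (forall n, n \in S -> exists u v, [/\ u \in U, v \in V & n = u * f v :> nat]) ->
  #|S| <= #|U| * #|V|.
Proof.
move=> HS; rewrite -finset.cardsX.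
pose g (uv : 'I_a.+1 * 'I_b.+1) : 'I_X.+1 := inord (uv.1 * f uv.2).
apply: leq_trans (leq_imset_card g _).
apply/subset_leq_card/fintype.subsetP => n /HS[u [v [uU vV E]]].
apply/imsetP; exists (u, v); first by rewrite !inE uU.
by apply: val_inj; rewrite /= inordK -E.
Qed.

Section Cover.
Variables (X r E h : nat) (G1 G2 : seq nat).
Let ps := 2 :: G1 ++ G2.
Hypothesis ups : uniq ps.
Hypothesis prps : all prime ps.
Hypothesis sG1 : size G1 = r.
Hypothesis G2E : (size G2).*2 <= E ^ r.
Hypothesis G1h : forall p, p \in G1 -> p <= 2 ^ h.
(** As 2 heads [ps], the primes of [G1] have indices 1 to [r] there, and the labels
    [(index q ps).*2 + eps] lie between 2 and [r.*2.+1]. *)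
Let B := r.*2.+2.
Let W := 2 ^ (h * E * r).

Let prime_ps q : q \in ps -> prime q.
Proof. exact: (allP prps). Qed.

Let in1 q : q \in G1 -> q \in ps.
Proof. by move=> qG; rewrite inE mem_cat qG orbT. Qed.

Let in2 q : q \in G2 -> q \in ps.
Proof. by move=> qG; rewrite inE mem_cat qG !orbT. Qed.

Let ups4 : [/\ 2 \notin G1 ++ G2, uniq G1, ~~ has (mem G1) G2 & uniq G2].
Proof. by move: ups; rewrite /ps cons_uniq cat_uniq => /and4P. Qed.

Let odd12 q : q \in G1 ++ G2 -> odd q.
Proof.
move=> qG; have pq : prime q by apply: prime_ps; rewrite inE qG orbT.
have [E2|//] := even_prime pq.
by have [+ _ _ _] := ups4; rewrite -E2 qG.
Qed.

Let disj12 q : q \in G1 -> q \notin G2.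
Proof.
move=> q1; have [_ _ /hasPn H _] := ups4.
by apply/negP => /H /=; rewrite q1.
Qed.

Lemma smooth_cycle : exists c, [/\ cycle dvd_rel c, uniq c,
    forall x, x \in c -> (among ps).-nat x /\ x <= X &
    forall g n a, (among G1).-nat g -> (among G2).-nat n ->
      g * n * 2 ^ B <= X -> n * (W * 2 ^ B) <= X -> g * n * 2 ^ a <= X ->
      g * n * 2 ^ a \in c].
Proof.
have W0 : 0 < W by rewrite expn_gt0.
(* If [X < W * 2 ^ B], no [n > 0] meets the condition on [n], and the empty cycle will do. *)
have [WX|WX] := leqP (W * 2 ^ B) X; last first.
  exists [::]; split=> // g n a _ /andP[n0 _] _ nX _.
  by move: WX; rewrite ltnNge => /negP[]; apply: leq_trans nX; rewrite leq_pmull.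
have [n2 uG1 _ uG2] := ups4.
have prG1 : all prime G1 by apply/allP => q /in1 /prime_ps.
have [w [Hw wI]] := code_words E uG1 prG1 G1h.
rewrite sG1 in Hw wI.
pose s m := odd (\sum_(p <- ps) logn p m).
pose lab (c : nat * bool) := (index c.1 ps).*2 + c.2.
pose wc (c : nat * bool) := w ((index c.1 G2).*2 + c.2).
have code_inj (i j : nat) (a b : bool) : i.*2 + a = j.*2 + b -> i = j /\ a = b.
  by case: a; case: b => /=; lia.
have wc_lt q a : q \in G2 -> (index q G2).*2 + nat_of_bool a < E ^ r.
  rewrite -index_mem => qG; apply: leq_trans G2E.
  by move: qG; case: a => /=; lia.
have flip m q : 0 < m -> prime q -> q \in ps -> s (m * q) = ~~ s m.
  move=> m0 pq qps; rewrite /s.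
  have -> : \sum_(p <- ps) logn p (m * q)
    = \sum_(p <- ps) logn p m + \sum_(p <- ps) (p == q).
    rewrite -big_split /=; apply: eq_bigr => p _.
    by rewrite lognM ?(prime_gt0 pq) // (logn_prime p pq).
  have -> : \sum_(p <- ps) (p == q) = 1.
    rewrite (bigD1_seq q) //= eqxx big1 ?addn0 // => p /negPf -> //.
  by rewrite oddD addbT.
have lab_r q : q \in G1 -> 0 < index q ps <= r.
  move=> qG; have q2 : q != 2.
    by apply: contraNneq n2 => <-; rewrite mem_cat qG.
  rewrite /ps /= eq_sym (negPf q2) /= index_cat qG.
  by rewrite -sG1 -index_mem in qG *.
have [||||||||||||||c [cc uc mc]] := @two_level_cycle X B W s (among G1) (among G2) lab wc.
- by move=> q qG; apply: odd12; rewrite mem_cat; apply/orP; left.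
- by move=> q qG; apply: odd12; rewrite mem_cat; apply/orP; right.
- by move=> q qG; apply: disj12.
- by move=> m q m0 pq qG; apply: flip => //; apply: in1.
- by move=> m q m0 pq qG; apply: flip => //; apply: in2.
- by move=> q a /lab_r; rewrite /lab /=; lia.
- by move=> q a /lab_r; rewrite /lab /B /=; case: a => /=; lia.
- move=> p q a b /in1 Gp /in1 Gq /code_inj [Ei Eab]; split=> //.
  by have := congr1 (nth 0 ps) Ei; rewrite !nth_index.
- by move=> q a qG; have [] := Hw ((index q G2).*2 + a).
- by move=> q a qG; have [] := Hw ((index q G2).*2 + a).
- move=> p q a b Gp Gq /wI Ew.
  have [Ei Eab] := code_inj _ _ _ _ (Ew (wc_lt _ _ Gp) (wc_lt _ _ Gq)); split=> //.
  by have := congr1 (nth 0 G2) Ei; rewrite !nth_index.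
- by [].
- by [].
- by [].
exists c; split=> //.
  move=> x /mc [g [n [a [Gg Gn _ _ [-> xX]]]]]; split=> //.
  have p2 : (among ps).-nat (2 ^ a) by rewrite pnatX pnatE.
  rewrite !pnatM p2 andbT; apply/andP; split.
    by apply: sub_in_pnat Gg => p _; apply: in1.
  by apply: sub_in_pnat Gn => p _; apply: in2.
by move=> g n a Gg Gn gX nX xX; apply/mc; exists g, n, a.
Qed.

(** A missed [n] is of one of two kinds. Either its odd part [k] has [X < k * 2 ^ B], and its
    exponent of 2 is below [B]; or its [G2]-part [u] has [X < u * (W * 2 ^ B)], and the cofactor is
    below [W * 2 ^ B]. *)
Lemma smooth_cycle_size : exists c, [/\ cycle dvd_rel c, uniq c,
    forall x, x \in c -> (among ps).-nat x /\ x <= X &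
    npnat (among ps) X <= size c + B * npnat (among (G1 ++ G2)) X
      + npnat (among G2) X * npnat (among (2 :: G1)) (W * 2 ^ B)].
Proof.
have [c [cc uc cps inc]] := smooth_cycle; exists c; split=> //.
pose S := [set n : 'I_X.+1 | (among ps).-nat n].
pose odd_part n := n`_(2^').
have sub2 : {subset among G2 <= 2^'}.
  move=> p; rewrite !inE => pG; apply/eqP => p2.
  by have [+ _ _ _] := ups4; rewrite mem_cat -p2 pG orbT.
pose S0 := [set n : 'I_X.+1 | val n \in c].
pose S1 := [set n in S | X < odd_part (n : nat) * 2 ^ B].
pose S2 := [set n in S | X < n`_(among G2) * (W * 2 ^ B)].
have oddP (n : nat) : (among ps).-nat n -> (among (G1 ++ G2)).-nat (odd_part n).
  move=> Sn; have h1 : (among ps).-nat (odd_part n) by apply: pnat_dvd Sn; apply: dvdn_part.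
  have h2 := part_pnat 2^' n.
  have := pnatI (among ps) 2^' (odd_part n); rewrite h1 h2 /= => h3.
  apply: sub_in_pnat h3 => p _; rewrite !inE => /andP[/orP[/eqP ->|->]] //.
have decomp (n : nat) : 0 < n -> n = odd_part n * 2 ^ logn 2 n.
  by move=> n0; rewrite -p_part mulnC partnC.
have cover : S \subset S0 :|: S1 :|: S2.
  apply/fintype.subsetP => n nS; rewrite !inE.
  have Sn : (among ps).-nat n by rewrite inE in nS.
  have /andP[n0 _] := Sn; rewrite Sn /=.
  have [k1|k1] := ltnP X (odd_part n * 2 ^ B); first by rewrite orbT.
  have [k2|k2] := ltnP X (n`_(among G2) * (W * 2 ^ B)); first by rewrite !orbT.
  rewrite !orbF.
  have E2 : n`_(among G2) = (odd_part n)`_(among G2) by rewrite partn_part.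
  have Gk := oddP _ Sn; have /andP[k0 _] := Gk.
  have Ek := partnC (among G2) k0; rewrite mulnC in Ek.
  have := inc (odd_part n)`_(among G2)^' (odd_part n)`_(among G2) (logn 2 n).
  rewrite Ek -decomp // -E2; apply=> //; last exact: leq_ord.
    have h1 := pnat_dvd (dvdn_part (among G2)^' (odd_part n)) Gk.
    have := pnatI (among (G1 ++ G2)) (among G2)^' (odd_part n)`_(among G2)^'.
    rewrite h1 part_pnat /= => h3; apply: sub_in_pnat h3 => p _.
    by rewrite !inE mem_cat => /andP[/orP[->|->]].
  exact: part_pnat.
have S0c : #|S0| <= size c.
  rewrite cardE -(size_map val); apply: uniq_leq_size.
    by rewrite map_inj_uniq ?enum_uniq //; apply: val_inj.
  by move=> x /mapP[n]; rewrite mem_enum inE => nc ->.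
have S1c : #|S1| <= npnat (among (G1 ++ G2)) X * B.
  rewrite -[X in _ * X](card_ord B) -(finset.cardsT 'I_B).
  apply: (card_ltn_mul (f := fun v => 2 ^ v)).
  move=> n; rewrite !inE => /andP[Sn kX].
  have /andP[n0 _] := Sn; have Gk := oddP _ Sn.
  have kn := decomp n n0.
  have kleX : odd_part n < X.+1.
    rewrite ltnS; apply: leq_trans (leq_ord n).
    by rewrite [X in _ <= X]kn leq_pmulr // expn_gt0.
  have aB : logn 2 n < B.
    rewrite -(ltn_exp2l (m := 2)) //; case/andP: Gk => k0 _.
    by rewrite -(ltn_pmul2l k0) -kn; apply: leq_ltn_trans kX; apply: leq_ord.
  by exists (Ordinal kleX), (Ordinal aB); rewrite !inE.
have S2c : #|S2| <= npnat (among G2) X * npnat (among (2 :: G1)) (W * 2 ^ B).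
  apply: (card_ltn_mul (f := id)) => n; rewrite !inE => /andP[Sn kX].
  have /andP[n0 _] := Sn.
  have nE := partnC (among G2) n0.
  have uX : n`_(among G2) < X.+1.
    rewrite ltnS; apply: leq_trans (leq_ord n).
    by rewrite -[X in _ <= X]nE leq_pmulr // part_gt0.
  have vX : n`_(among G2)^' < (W * 2 ^ B).+1.
    rewrite ltnS -(leq_pmul2l (part_gt0 (among G2) n)) nE; apply/ltnW.
    by apply: leq_ltn_trans kX; apply: leq_ord.
  exists (Ordinal uX), (Ordinal vX); rewrite !inE /= part_pnat nE; split=> //.
  have h1 : (among ps).-nat n`_(among G2)^' by apply: pnat_dvd Sn; apply: dvdn_part.
  have h2 := part_pnat (among G2)^' n.
  have := pnatI (among ps) (among G2)^' n`_(among G2)^'; rewrite h1 h2 /=.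
  by apply: sub_in_pnat => p _; rewrite !inE mem_cat => /andP[/or3P[->|->|->]] //; rewrite ?orbT.
apply: leq_trans (subset_leq_card cover) _.
apply: leq_trans (leq_card_setU _ _) _; apply: leq_add => //.
apply: leq_trans (leq_card_setU _ _) _; apply: leq_add => //.
by rewrite mulnC.
Qed.

End Cover.

(** * Chebyshev bounds and choice of parameters *)

Lemma exp2_leq_central_bin n : 2 ^ n <= 'C(n.*2, n).
Proof.
elim: n => [|n IHn]; first by rewrite bin0.
rewrite doubleS binS -[X in 'C(X, _) + _]/(n.*2.+1).
have -> : 'C(n.*2.+1, n.+1) = 'C(n.*2.+1, n).
  by rewrite -[RHS]bin_sub; [congr ('C(_, _)); lia | lia].
rewrite addnn -mul2n expnS leq_mul2l /=; apply: leq_trans IHn _.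
by case: n => // n; rewrite [X in _ <= X]binS leq_addr.
Qed.

(** By Legendre's formula the exponent is a sum of terms [n.*2 %/ p ^ k - (n %/ p ^ k).*2], each at
    most 1, and 0 once [p ^ k > n.*2]. *)
Lemma logn_central_bin n p : prime p ->
  logn p 'C(n.*2, n) <= trunc_log p n.*2.
Proof.
move=> pp; have p1 := prime_gt1 pp; set L := trunc_log _ _.
have le : n <= n.*2 by rewrite -addnn leq_addr.
have := congr1 (logn p) (bin_fact le).
have -> : n.*2 - n = n by rewrite -addnn addnK.
rewrite lognM ?muln_gt0 ?fact_gt0 ?bin_gt0 // lognM ?fact_gt0 // !logn_fact //.
(* Zero terms are added so that both Legendre sums have the same range. *)
have ext : \sum_(1 <= k < n.+1) n %/ p ^ k = \sum_(1 <= k < n.*2.+1) n %/ p ^ k.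
  rewrite [RHS](big_cat_nat (n := n.+1)) //= big_nat [X in _ = _ + X]big_nat_cond.
  rewrite [X in _ = _ + X]big1 ?addn0 -?big_nat // => k /andP[/andP[nk _] _].
  by rewrite divn_small // (ltn_trans nk) // ltn_expl.
rewrite ext addnn => E.
suff : \sum_(1 <= k < n.*2.+1) n.*2 %/ p ^ k
   <= (\sum_(1 <= k < n.*2.+1) n %/ p ^ k).*2 + L by rewrite -E addnC leq_add2l.
apply: (@leq_trans (\sum_(1 <= k < n.*2.+1) ((n %/ p ^ k).*2 + (k <= L)))).
  apply: leq_sum => k _; case: (leqP k L) => kL /=; last first.
    rewrite divn_small //; apply: leq_trans (trunc_log_ltn _ p1) _.
    by rewrite leq_exp2l.
  have pk : 0 < p ^ k by rewrite expn_gt0 prime_gt0.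
  rewrite -ltnS ltn_divLR //.
  have := ltn_ceil n pk; rewrite -!muln2; nia.
rewrite big_split /= leq_add //.
  by rewrite -[X in _ <= X]muln2 big_distrl /=; apply: leq_sum => k _; rewrite muln2.
rewrite -big_mkcond /= sum1_count /index_iota subSS subn0.
apply: (@leq_trans (size (iota 1 L))); last by rewrite size_iota.
rewrite -size_filter; apply: uniq_leq_size; first by rewrite filter_uniq ?iota_uniq.
by move=> k; rewrite mem_filter !mem_iota => /and3P[kL k1 _]; rewrite k1 /=; lia.
Qed.

Definition primes_upto N := [seq p <- iota 0 N.+1 | prime p].

Lemma mem_primes_upto N p : (p \in primes_upto N) = prime p && (p <= N).
Proof. by rewrite mem_filter mem_iota. Qed.

Lemma primes_upto_uniq N : uniq (primes_upto N).
Proof. by rewrite filter_uniq ?iota_uniq. Qed.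

Lemma primes_upto_sorted N : sorted ltn (primes_upto N).
Proof. by apply: sorted_filter; [exact: ltn_trans | exact: iota_ltn_sorted]. Qed.

Lemma central_bin_prod n : 0 < n -> 'C(n.*2, n) =
  \prod_(p <- primes_upto n.*2) p ^ logn p 'C(n.*2, n).
Proof.
move=> n0; apply: pnat_prodE; first exact: primes_upto_uniq.
  by apply/allP => p; rewrite mem_primes_upto => /andP[].
have le : n <= n.*2 by rewrite -addnn leq_addr.
apply/pnatP; first by rewrite bin_gt0.
move=> p pp pC; rewrite inE mem_primes_upto pp.
have : 0 < logn p 'C(n.*2, n) by rewrite logn_gt0 mem_primes pp bin_gt0 le.
move=> /leq_trans /(_ (logn_central_bin n pp)) L0.
by move: L0; rewrite trunc_log_gt0 => /andP[_]; case: p {pC} pp.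
Qed.

(** With [n = 2 ^ h], each prime power in ['C(n.*2, n) >= 2 ^ n] is at most [n.*2 = 2 ^ h.+1]. *)
Lemma prime_count_lower h : 2 ^ h <= h.+1 * size (primes_upto (2 ^ h.+1)).
Proof.
have E : 2 ^ h.+1 = (2 ^ h).*2 by rewrite expnS mul2n.
rewrite -(leq_exp2l (m := 2)) //; apply: leq_trans (exp2_leq_central_bin _) _.
rewrite central_bin_prod ?expn_gt0 // -E expnM -sum1_size expn_sum !big_seq.
apply: leq_prod => p; rewrite mem_primes_upto expn1 => /andP[pp _].
apply: leq_trans (trunc_logP (prime_gt1 pp) _); last by rewrite expn_gt0.
by rewrite leq_exp2l ?prime_gt1 // E logn_central_bin.
Qed.

(** With [n = 2 ^ i], all primes in [(n, 2n]] divide ['C(n.*2, n) <= 2 ^ n.*2], and each exceeds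
    [2 ^ i]. *)
Lemma prime_count_double i :
  i * size (primes_upto (2 ^ i.+1)) <= i * size (primes_upto (2 ^ i)) + 2 ^ i.+1.
Proof.
set n := 2 ^ i; have n0 : 0 < n by rewrite expn_gt0.
have E : 2 ^ i.+1 = n.*2 by rewrite expnS mul2n.
pose A := [seq p <- iota n.+1 n | prime p].
have E2 : primes_upto n.*2 = primes_upto n ++ A.
  by rewrite /primes_upto /A -filter_cat -addnn -addSn iotaD add0n.
rewrite E E2 size_cat mulnDr leq_add2l -(leq_exp2l (m := 2)) //.
apply: leq_trans (leq_bin_exp2 n.*2 n); rewrite expnM -/n.
have le : n <= n.*2 by rewrite -addnn leq_addr.
have C0 : 0 < 'C(n.*2, n) by rewrite bin_gt0.
rewrite central_bin_prod // E2 big_cat /=.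
apply: (@leq_trans (\prod_(p <- A) p ^ logn p 'C(n.*2, n))); last first.
  rewrite leq_pmull // prod_exp_gt0 //; apply/allP => p.
  by rewrite mem_primes_upto => /andP[].
rewrite -sum1_size expn_sum !big_seq; apply: leq_prod => p.
rewrite mem_filter mem_iota expn1 => /and3P[pp np p2].
suff pC : p %| 'C(n.*2, n).
  apply: leq_trans (ltnW np) _; rewrite -[X in X <= _]expn1.
  by rewrite leq_exp2l ?prime_gt1 // logn_gt0 mem_primes pp C0.
have : p %| n.*2`! by apply: dvdn_fact; rewrite prime_gt0 //; lia.
rewrite -(bin_fact le) -addnn addnK !Euclid_dvdM // addnn => /orP[//|].
rewrite orbb -[p in p %| _]expn1 pfactor_dvdn ?fact_gt0 // logn_fact //.
rewrite big_nat big1 // => k /andP[k1 _]; rewrite divn_small //.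
by apply: leq_trans np _; rewrite -[X in X <= _]expn1 leq_pexp2l // prime_gt0.
Qed.

Lemma prime_count_upper i : i * size (primes_upto (2 ^ i)) <= 4 * 2 ^ i.
Proof.
elim: i => [|i IHi] //.
(* The induction step amounts to [6 * i.+1 <= 8 * i], hence the threshold 3. *)
have [i2|i3] := leqP i 2; first by case: i i2 {IHi} => [|[|[|]]].
have i0 : 0 < i by lia.
rewrite -(leq_pmul2l i0) mulnCA.
apply: (@leq_trans (i.+1 * (6 * 2 ^ i))).
  rewrite leq_mul2l /=; apply: leq_trans (prime_count_double i) _.
  by rewrite expnS; lia.
rewrite expnS; nia.
Qed.

Lemma cube_leq_exp2 m : 10 <= m -> m ^ 3 <= 2 ^ m.
Proof.
elim: m => // m IHm; rewrite leq_eqVlt => /orP[/eqP <- //|m10].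
have := IHm m10; rewrite [2 ^ m.+1]expnS !expnS expn0; nia.
Qed.

(* With [l = trunc_log 2 Y], take [r = (l + 1) / 512] and [h] of order
   [2 log log Y]: then [h ^ 2] is far below [l], while there are more than [r]
   primes up to [2 ^ h]. *)
Lemma parameters_exist : exists Y0 E, forall Y, Y0 <= Y ->
  let k := size (primes_upto Y) in exists r h,
  [/\ r < size (primes_upto (2 ^ h)), 2 ^ h <= Y, k.*2 <= E ^ r,
     16 * r.+1.*2 * k <= Y & 64 * h * k * (h * E + 2) <= Y].
Proof.
(* With [r] as below, [l.+1 < 512 * r.+1 <= 1024 * r], whence [k.*2 <= 2 ^ l.+2 <= E ^ r]. *)
have [E HE] : exists E, forall r, 2 ^ (1024 * r) <= E ^ r.
  by exists (2 ^ 1024) => r; rewrite expnM.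
(* For [m >= m0], of order log log Y, [m ^ 3 <= 2 ^ m <= l.+1] dominates the quadratic expression in
   [hl]. *)
pose m0 := 10 + 2048 * (E + 2).
exists (2 ^ (2 ^ m0)), E => Y YY0 k.
have Y0 : 0 < Y by apply: leq_trans YY0; rewrite expn_gt0.
set l := trunc_log 2 Y.
have l0 : 2 ^ m0 <= l by apply: trunc_log_max.
set m := trunc_log 2 l.+1.
have mm0 : m0 <= m by apply: trunc_log_max => //; apply: leqW.
have ml : 2 ^ m <= l.+1 by apply: trunc_logP.
have lm : l.+1 < 2 ^ m.+1 by apply: trunc_log_ltn.
have Yl : 2 ^ l <= Y by apply: trunc_logP.
have lY : Y < 2 ^ l.+1 by apply: trunc_log_ltn.
have kl : k * l.+1 <= 8 * Y.
  apply: (@leq_trans (l.+1 * size (primes_upto (2 ^ l.+1)))).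
    rewrite mulnC leq_mul2l /=; apply: uniq_leq_size; first exact: primes_upto_uniq.
    move=> p; rewrite !mem_primes_upto => /andP[-> pY] /=.
    exact: leq_trans pY (ltnW lY).
  by apply: leq_trans (prime_count_upper _) _; rewrite expnS; lia.
have m10 : 10 <= m by apply: leq_trans mm0; rewrite /m0; lia.
have m3 := cube_leq_exp2 m10.
have hl : 512 * m.*2 * (m.*2 * E + 2) <= l.+1.
  apply: leq_trans ml; apply: leq_trans m3; rewrite !expnS expn0.
  have : 2048 * (E + 2) <= m by apply: leq_trans mm0; rewrite /m0; lia.
  clear -m10; nia.
have l512 : 512 <= l.+1.
  apply: leq_trans ml; apply: (@leq_trans (2 ^ 10)) => //.
  by rewrite leq_exp2l.
pose r := l.+1 %/ 512; exists r, m.*2.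
have r0 : 0 < r by rewrite divn_gt0.
have rl : r * 512 <= l.+1 by apply: leq_divM.
have lr : l.+1 < r.+1 * 512 by apply: ltn_ceil.
(* Chebyshev's bound [k <= 8 * Y / l.+1] reduces the last two requirements to inequalities with
   [l.+1]. *)
have bnd c : c * 8 <= l.+1 -> c * k <= Y.
  move=> cl; rewrite -(leq_pmul2r (ltn0Sn l)) -mulnA.
  apply: (@leq_trans (c * (8 * Y))); first by rewrite leq_mul2l kl orbT.
  by rewrite mulnA [Y * _]mulnC leq_mul2r cl orbT.
split.
- have := prime_count_lower m.*2.-1; rewrite prednK; last by lia.
  set P := size _; rewrite -(ltn_pmul2l (m := m.*2)); last by lia.
  apply: leq_trans.
  (* The factor [2 ^ m.+1] exceeds [l.+1 >= r], and [2 ^ (m - 2)] absorbs [m.*2]. *)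
  have -> : m.*2.-1 = (m.+1 + (m - 2)) by lia.
  rewrite expnD.
  have m2 : m.*2 <= 2 ^ (m - 2).
    have -> : m - 2 = (m - 6).+4 by lia.
    rewrite !expnS; have := ltn_expl (m - 6) (isT : 1 < 2); lia.
  apply: (@leq_trans (m.*2 * l.+1)).
    rewrite ltn_pmul2l; lia.
  by rewrite mulnC leq_mul // ltnW.
- apply: leq_trans Yl; rewrite leq_exp2l //; rewrite -ltnS.
  apply: leq_trans ml; apply: leq_trans m3; rewrite !expnS expn0; clear -m10; nia.
- apply: leq_trans (HE r); apply: (@leq_trans (2 ^ l.+2)).
    rewrite expnS mul2n leq_double; apply: leq_trans (ltnW lY).
    apply: (@leq_trans (size (iota 1 Y))); last by rewrite size_iota.
    apply: uniq_leq_size; first exact: primes_upto_uniq.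
    by move=> p; rewrite mem_primes_upto mem_iota add1n ltnS => /andP[/prime_gt0 -> ->].
  rewrite leq_exp2l //; lia.
- by apply: bnd; lia.
- have -> : 64 * m.*2 * k * (m.*2 * E + 2) = 64 * m.*2 * (m.*2 * E + 2) * k by rewrite mulnAC.
  apply: bnd; apply: leq_trans hl; rewrite mulnC !mulnA; lia.
Qed.

(** * The lower bound *)

Lemma primes_upto_cat M N : M <= N ->
  primes_upto N = primes_upto M ++ [seq p <- iota M.+1 (N - M) | prime p].
Proof.
move=> MN; rewrite /primes_upto; have -> : N.+1 = M.+1 + (N - M) by lia.
by rewrite iotaD filter_cat add0n.
Qed.

(** [L1] and [L2] are the two losses of [smooth_cycle_size]. The first is bounded by removing the
    prime 2 alone, the second by removing the [r.+1] smallest primes, which gains a power [r.+1] to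
    absorb the number of cofactors. *)
Lemma smooth_cycle_loss X Y r E h : let k := size (primes_upto Y) in
  let N := npnat (among (primes_upto Y)) X in
  r < size (primes_upto (2 ^ h)) -> 2 ^ h <= Y -> k.*2 <= E ^ r ->
  exists c L1 L2, [/\ cycle dvd_rel c, uniq c,
    forall x, x \in c -> (among (primes_upto Y)).-nat x /\ x <= X,
    N <= size c + L1 + L2 &
    trunc_log 2 X * L1 <= 4 * r.+1 * k * N /\
    trunc_log (2 ^ h) X ^ r.+1 * L2 <= (8 * k * (h * E + 2)) ^ r.+1 * N].
Proof.
move=> k N rh hY kE.
have h0 : 0 < h by case: h rh {hY}.
have Y2 : 2 <= Y by apply: leq_trans hY; rewrite -[X in X <= _]expn1 leq_exp2l.
have [A EA] : exists A, primes_upto Y = 2 :: A.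
  exists [seq p <- iota 3 (Y - 2) | prime p].
  by rewrite (primes_upto_cat Y2).
have kA : (size A).+1 = k by rewrite /k EA.
have up := primes_upto_uniq Y; have sp := primes_upto_sorted Y.
have pp : all prime (primes_upto Y).
  by apply/allP => p; rewrite mem_primes_upto => /andP[].
have rk : r < k.
  by apply: leq_trans rh _; rewrite /k (primes_upto_cat hY) size_cat leq_addr.
have takeE : 2 :: take r A = take r.+1 (primes_upto (2 ^ h)).
  rewrite -[LHS]/(take r.+1 (2 :: A)) -EA (primes_upto_cat hY) takel_cat //.
have sG1 : size (take r A) = r by rewrite size_takel // -ltnS kA.
have G1h p : p \in 2 :: take r A -> p <= 2 ^ h.
  by rewrite takeE => /mem_take; rewrite mem_primes_upto => /andP[].
have G2E : (size (drop r A)).*2 <= E ^ r.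
  by apply: leq_trans kE; rewrite leq_double size_drop; lia.
have EA' : primes_upto Y = 2 :: take r A ++ drop r A by rewrite cat_take_drop.
rewrite /N; rewrite EA' in up sp pp *.
have [c [cc uc cin Nc]] := smooth_cycle_size X up pp sG1 G2E
  (fun p pG => G1h p (mem_behead (s := 2 :: take r A) pG)).
exists c, (r.*2.+2 * npnat (among (take r A ++ drop r A)) X),
 (npnat (among (drop r A)) X *
  npnat (among (2 :: take r A)) (2 ^ (h * E * r) * 2 ^ r.*2.+2)).
split=> //; rewrite -/N; split.
  have /andP[_ pA] := pp; have /andP[n2 uA] := up.
  have := @mass_transfer X 2 _ isT uA pA (order_path_min ltn_trans sp).
  have -> : (size (take r A ++ drop r A)).+1 = k by rewrite cat_take_drop.
  set a := npnat _ _; set b := npnat _ _ => H.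
  rewrite mulnCA.
  apply: (@leq_trans (r.*2.+2 * (2 * k * b))); first by rewrite leq_mul2l H orbT.
  by rewrite !mulnA -doubleS -muln2; apply: eq_leq; congr (_ * _); lia.
have HQ p : p \in 2 :: take r A -> trunc_log (2 ^ h) X <= trunc_log p X.
  move=> pG; have p1 : 1 < p.
    by apply: prime_gt1; apply: (allP pp); rewrite -cat_cons mem_cat pG.
  case: (posnP X) => [->|X0]; first by rewrite trunc_log0.
  apply: trunc_log_max => //.
  apply: (@leq_trans ((2 ^ h) ^ trunc_log (2 ^ h) X)).
    by case: trunc_log => // j; rewrite leq_exp2r ?G1h.
  by apply: trunc_logP; rewrite // -[X in X < _](expn0 2) ltn_exp2l.
have := @iter_mass_transfer X _ (2 :: take r A) (drop r A) sp pp HQ.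
have -> : size ((2 :: take r A) ++ drop r A) = k by rewrite cat_cons cat_take_drop.
have sz : size (2 :: take r A) = r.+1 by rewrite /= sG1.
rewrite sz.
set a := npnat _ _; set b := npnat _ _; set d := npnat _ _ => H.
(* The cofactors are at most [2 ^ (h * E * r + r.*2.+2)], with exponent at most
   [r.+1 * (h * E + 2)], so [sigma = h * E + 2] is suitable. *)
have D : d <= (4 * (h * E + 2)) ^ r.+1.
  rewrite /d -expnD -sz.
  apply: npnat_exp2_le.
  - by move: up; rewrite -cat_cons cat_uniq => /and3P[].
  - by move: pp; rewrite -cat_cons all_cat => /andP[].
  - by rewrite addn2.
  - by rewrite sz -muln2; nia.
rewrite mulnA.
apply: (@leq_trans ((2 * k) ^ r.+1 * b * (4 * (h * E + 2)) ^ r.+1)).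
  exact: leq_mul.
by rewrite mulnAC -expnMn; apply: eq_leq; congr (_ ^ _ * _); lia.
Qed.

(** * From integers to real [x] and [y] *)

Section RealBounds.
Local Open Scope ring_scope.
Variables (R : realType).

Lemma ln_lt_trunc_log (x : R) h : (0 < h)%N -> 1 <= x ->
  ln x < h%:R * (trunc_log (2 ^ h) (Num.truncn x)).+1%:R.
Proof.
move=> h0 x1; set Q := trunc_log _ _.
have x0 : 0 < x by apply: lt_le_trans x1.
have /andP[_ xX] := truncn_itv (ltW x0).
have h1 : (1 < 2 ^ h)%N by rewrite -[X in (X < _)%N](expn0 2) ltn_exp2l.
have XQ : ((Num.truncn x).+1 <= 2 ^ (h * Q.+1))%N by rewrite expnM trunc_log_ltn.
have xQ : x < 2 ^+ (h * Q.+1).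
  by apply: lt_le_trans xX _; rewrite -natrX ler_nat.
have lnQ : ln x < ln (2 ^+ (h * Q.+1) : R).
  by rewrite ltr_ln ?posrE ?exprn_gt0.
apply: lt_le_trans lnQ _; rewrite lnXn // -natrM -[leLHS]mulr_natr.
have l2 : ln (2 : R) <= 1 by apply: (@le_ln1Dx R 1); lra.
by rewrite ler_piMl.
Qed.

Lemma Psi_leq (x y : R) : 0 <= x -> 0 <= y ->
  (Psi x y <= npnat (among (primes_upto (Num.truncn y))) (Num.truncn x))%N.
Proof.
move=> x0 y0; rewrite /npnat cardE -(size_map val) /Psi.
apply: uniq_leq_size => // n; rewrite in_fset_set; last exact: finite_smooth.
rewrite inE => -[n0 nx ny].
have nX : (n < (Num.truncn x).+1)%N by rewrite ltnS truncn_ge_nat.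
apply/mapP; exists (Ordinal nX) => //; rewrite mem_enum inE /=.
apply/pnatP => // p pp pn; rewrite inE mem_primes_upto pp /=.
rewrite truncn_ge_nat //; apply: le_trans ny; rewrite ler_nat.
by apply: max_pdiv_max; rewrite mem_primes pp n0.
Qed.

Lemma size_le_max_chain (x y : R) c : 0 <= x -> 2 <= y ->
  cycle dvd_rel c -> uniq c ->
  (forall n, n \in c -> (among (primes_upto (Num.truncn y))).-nat n /\
     (n <= Num.truncn x)%N) ->
  (size c <= max_chain_length x y)%N.
Proof.
move=> x0 y2 cc uc cin; have y0 : 0 <= y by apply: le_trans y2.
rewrite /max_chain_length; case: ex_maxnP => m _; apply; apply/asboolP.
exists c; split=> //.
  rewrite /chain uc /=; apply/andP; split.
    by apply/allP => n /cin [/andP[]].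
  by case: c cc {uc cin} => //= n c; rewrite rcons_path => /andP[].
move=> n nc; have [nY nX] := cin n nc; have /andP[n0 _] := nY.
split=> //; first by rewrite -truncn_ge_nat.
have [n1|n1] := leqP n 1.
  have -> : n = 1%N by lia.
  by apply: le_trans y2; rewrite ler_nat.
have := pnatPpi nY (_ : max_pdiv n \in \pi(n)); rewrite pi_max_pdiv n1 => /(_ isT).
by rewrite inE mem_primes_upto truncn_ge_nat // => /andP[].
Qed.

End RealBounds.

Local Open Scope ring_scope.

Theorem theorem1p2 (R : realType) :
  exists C : R, 0 < C /\
    forall x y : R, 2 <= y -> y <= ln x ->
      (Psi x y)%:R / (1 + y / ln x)
        * (1 - C * (ln y / y + y / (ln x * ln y))) <= (max_chain_length x y)%:R
      /\ (max_chain_length x y)%:R <= (Psi x y)%:R :> R.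
Proof.
have [Y0 [E HE]] := parameters_exist.
have ln2 : 0 < ln (2 : R) by rewrite ln_gt0 // ltr1n.
(* This makes [C * (ln y / y) >= 1] whenever [y <= Y0.+1], because [ln 2 <= ln y]. *)
exists (Y0.+1%:R / ln 2); split; first by rewrite divr_gt0.
move=> x y y2 yx; set C := (Y0.+1%:R / ln 2).
have C0 : 0 < C by rewrite divr_gt0.
split; last first.
  rewrite ler_nat /max_chain_length; case: ex_maxnP => m Hm _.
  exact: has_chain_le Hm.
have y0 : 0 < y by apply: lt_le_trans y2.
set u := ln x in yx *; have u0 : 0 < u by apply: lt_le_trans yx.
have x1 : 1 <= x.
  rewrite leNgt; apply/negP => x1; have := ln_le0 (ltW x1).
  by rewrite -/u leNgt u0.
have x0 : 0 <= x by apply: le_trans x1.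
have lny : ln 2 <= ln y by rewrite ler_ln ?posrE.
have lny0 : 0 < ln y by apply: lt_le_trans lny.
have err0 : 0 <= y / (u * ln y) by rewrite divr_ge0 ?mulr_ge0 // ltW.
have t0 : 0 <= y / u by rewrite divr_ge0 // ltW.
have [yY|yY] := ltnP (Num.truncn y) Y0.
  apply: le_trans (ler0n _ _).
  apply: mulr_ge0_le0; first by rewrite divr_ge0 // addr_ge0.
  rewrite subr_le0.
  have /andP[_ yT] := truncn_itv (ltW y0).
  have yY0 : y <= Y0.+1%:R.
    by apply: le_trans (ltW yT) _; rewrite ler_nat ltnS ltnW.
  have H : 1 <= C * (ln y / y).
    rewrite /C mulrA ler_pdivlMr // mul1r mulrAC ler_pdivlMr //.
    by apply: ler_pM => //; apply: ltW.
  by apply: le_trans H _; rewrite ler_pM2l // lerDl.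
have [r [h [rh hY kE c1 c2]]] := HE _ yY.
set Y := Num.truncn y in rh hY kE c1 c2; set X := Num.truncn x.
have [c [L1 [L2 [cc uc cin Nc [HL1 HL2]]]]] := smooth_cycle_loss X rh hY kE.
set k := size (primes_upto Y) in c1 c2 HL1 HL2 Nc.
set N := npnat _ _ in HL1 HL2 Nc.
have cf := size_le_max_chain x0 y2 cc uc cin.
have PN := Psi_leq x0 (ltW y0); rewrite -/N in PN.
have h0 : (0 < h)%N by case: h rh {hY c2 HL2}.
have k0 : (0 < k)%N.
  apply: leq_trans (leq_ltn_trans (leq0n _) rh) _.
  by rewrite /k (primes_upto_cat hY) size_cat leq_addr.
have Yy : Y%:R <= y by have /andP[] := truncn_itv (ltW y0).
set t := y / u in t0 *.
have t1 : t <= 1 by rewrite ler_pdivrMr // mul1r.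
have tu : t * u = y by rewrite divfK // gt_eqF.
(* Here [u / 2 <= u - 1 <= q0] and [4 * r.+1 * k <= y / 8], so [L1 <= y / (4 * u) * N]. *)
have L1t : L1%:R <= t / 4 * N%:R :> R.
  have := ln_lt_trunc_log (isT : (0 < 1)%N) x1; rewrite expn1 mul1r -/X -/u.
  set q0 := trunc_log 2 X in HL1 *; rewrite -natr1 => uq.
  have u2 : 2 <= u by apply: le_trans yx.
  have {}HL1 : q0%:R * L1%:R <= 4 * r.+1%:R * k%:R * N%:R :> R.
    by rewrite -!natrM ler_nat.
  have {}c1 : 32 * (r.+1%:R * k%:R) <= y.
    apply: le_trans Yy; rewrite -!natrM ler_nat; apply: leq_trans c1.
    by apply: eq_leq; rewrite -muln2; ring.
  have uL : u / 2 * L1%:R <= q0%:R * L1%:R by apply: ler_wpM2r => //; lra.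
  have cN : 32 * (r.+1%:R * k%:R) * N%:R <= y * N%:R by apply: ler_wpM2r.
  have : u / 2 * L1%:R <= u / 2 * (t / 4 * N%:R).
    have -> : u / 2 * (t / 4 * N%:R) = (t * u) / 8 * N%:R by field.
    by rewrite tu; lra.
  by rewrite ler_pM2l // divr_gt0.
(* From [u <= 2 * h * q] and [8 * h * a <= y = t * u] follows [a / q <= t / 4]; its power [r.+1] is
   at most [t / 4], as [t <= 1]. *)
have L2t : L2%:R <= t / 4 * N%:R :> R.
  have := ln_lt_trunc_log h0 x1; rewrite -/X -/u.
  set q := trunc_log _ X in HL2 *; rewrite -natr1 => uq.
  have hu : h%:R * 2 <= u.
    apply: le_trans yx; apply: le_trans Yy; rewrite -natrM ler_nat.
    apply: leq_trans c2; apply: (@leq_trans (h * 2 * (32 * k * (h * E + 2)))%N).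
      by rewrite leq_pmulr // !muln_gt0 k0 addn2.
    by apply: eq_leq; ring.
  set a := (8 * k * (h * E + 2))%N in HL2.
  have hR : 0 < h%:R :> R by rewrite ltr0n.
  have uhq : u <= 2 * h%:R * q%:R by lra.
  have q0 : 0 < q%:R :> R.
    have h2 : 0 < 2 * h%:R :> R by rewrite mulr_gt0.
    by rewrite -(pmulr_rgt0 _ h2); apply: lt_le_trans uhq.
  have ha : 8 * (h%:R * a%:R) <= y.
    apply: le_trans Yy; rewrite -!natrM ler_nat; apply: leq_trans c2.
    by rewrite /a; apply: eq_leq; ring.
  have aq : a%:R <= t / 4 * q%:R.
    have th : t * u <= t * (2 * h%:R * q%:R) by apply: ler_wpM2l.
    rewrite tu in th.
    have : h%:R * a%:R <= h%:R * (t / 4 * q%:R) by lra.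
    by rewrite ler_pM2l.
  have {}HL2 : q%:R ^+ r.+1 * L2%:R <= a%:R ^+ r.+1 * N%:R :> R.
    by rewrite -!natrX -!natrM ler_nat.
  have t4 : 0 <= t / 4 by rewrite divr_ge0.
  have : q%:R ^+ r.+1 * L2%:R <= q%:R ^+ r.+1 * (t / 4 * N%:R).
    apply: le_trans HL2 _; rewrite mulrA; apply: ler_wpM2r => //.
    apply: (@le_trans _ _ ((t / 4 * q%:R) ^+ r.+1)); first by rewrite lerXn2r ?nnegrE // mulr_ge0.
    rewrite exprMn mulrC ler_pM2l ?exprn_gt0 // exprS ler_piMr // exprn_ile1 //; lra.
  by rewrite ler_pM2l // exprn_gt0.
set f := max_chain_length x y in cf *.
have Nf : N%:R <= f%:R + L1%:R + L2%:R :> R.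
  by rewrite -!natrD ler_nat; apply: leq_trans Nc _; rewrite !leq_add2r.
have t1p : 0 < 1 + t by lra.
(* For large [y] the factor with [C] is bounded by 1. *)
apply: (@le_trans _ _ ((Psi x y)%:R / (1 + t))).
  rewrite ler_piMr ?divr_ge0 //; first exact: ltW.
  rewrite gerBl; apply: mulr_ge0; first exact: ltW.
  by apply: addr_ge0 => //; apply: divr_ge0; exact: ltW.
rewrite ler_pdivrMr //; apply: (@le_trans _ _ N%:R); first by rewrite ler_nat.
have N0 : 0 <= N%:R :> R by [].
have Nf' : N%:R * (1 - t / 2) <= f%:R by lra.
have : N%:R * (1 - t / 2) * (1 + t) <= f%:R * (1 + t) by apply: ler_wpM2r => //; exact: ltW.
(* For [0 <= t <= 1], [(1 - t / 2) * (1 + t) = 1 + t * (1 - t) / 2 >= 1]. *)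
apply: le_trans; rewrite -mulrA ler_peMr //; nra.
Qed.
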